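(* Let $p\ge 2$ be an even integer, $m\ge 3$ an odd integer, and let $G$ be a $(p,q)$-graph with $V(G)=\{u_i \mid 1\le i\le p\}$. Suppose the following three conditions hold. (a) For some $t\ge 2$, $G$ is a $t$-partite graph with partite sets $V_l$, $1\le l\le t$, such that $|V_l|=s_l$ with $s_{l+1}\ge s_l\ge 1$. (b) $G$ admits a bijective total labeling $g:V(G)\cup E(G)\to[1,p+q]$, with induced color of $u$ given by $g^+_{tn}(u)=\sum_{x\in N(u)}[g(ux)+g(x)]$, such that for each $1\le l\le t$: if $s_l=1$, then the only induced color in $V_l$ is $\alpha_l$; and if $s_l\ge 2$, then all the induced colors of the vertices of $V_l$ form (in some order) an arithmetic sequence with first term $\alpha_l$ and common difference $d_l$. (A) There exists a $p\times m$ matrix $A_{p\times m}$ whose set of entries is $[1,pm]$, all of whose column sums are equal to the constant $p(pm+1)/2$, and whose $p$ row sums (one for each row) can be partitioned into $t$ collections $S_l$, $1\le l\le t$, with $S_l$ of size $s_l$, such that: if $s_l=1$, then the only element of $S_l$ is $\beta_l$; and if $s_l\ge 2$, then all the elements of $S_l$ form (in some order) an arithmetic sequence with first term $\beta_l$ and common difference $-d_l$. Suppose moreover that (i) $\alpha_l+\beta_l\ne\alpha_{l'}+\beta_{l'}$ for all $1\le l<l'\le t$, and (ii) for all $1\le l\le t$, $$\alpha_l+\beta_l+m(2p+2q+pm)+\frac{m(m+1)}{2}\ne\sum_{i=1}^p g(u_i)+\frac{p(pm+1)}{2}+p(p+q).$$ Then $\chi_{ltna}(G\vee O_m)\le t+1$.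 Equality holds if $\chi(G)=t$.
   Context: All graphs are finite and simple. A $(p,q)$-graph is a graph with $p$ vertices and $q$ edges. For integers $a<b$, $[a,b]=\{a,a+1,\dots,b\}$. $N(u)$ is the set of neighbors of $u$; $\chi$ is the chromatic number. $O_m$ is the null (edgeless) graph on $m$ vertices. The join $G\vee H$ of (vertex-disjoint) graphs has $V(G\vee H)=V(G)\cup V(H)$ and $E(G\vee H)=E(G)\cup E(H)\cup\{uv\mid u\in V(G),v\in V(H)\}$. For a graph $G=(V,E)$ of order $p$ and size $q$, a bijective total labeling is a bijection $f:V\cup E\to\{1,\dots,p+q\}$; its induced vertex coloring is $f^+_{tn}(u)=\sum_{ux\in E}[f(ux)+f(x)]$, with $f^+_{tn}(u)=0$ if $u$ is isolated. Such an $f$ is a local total neighborhood antimagic labeling of $G$ if $f^+_{tn}(u)\ne f^+_{tn}(v)$ for every edge $uv\in E$. The number of distinct induced colors is $c_{tn}(f)$. The local total neighborhood antimagic chromatic number $\chi_{ltna}(G)$ is the minimum of $c_{tn}(f)$ over all local total neighborhood antimagic labelings $f$ of $G$. It is considered for graphs of order at least 2 without isolated vertices that admit such a labeling; thus an assertion $\chi_{ltna}(G)\le k$ or $\chi_{ltna}(G)=k$ includes the assertion that $G$ admits such a labeling. *)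

(* Defs.v *)
From mathcomp Require Import all_boot all_order all_algebra.

Set Implicit Arguments.
Unset Strict Implicit.
Unset Printing Implicit Defensive.

Record sgraph := SGraph {
  vertex :> finType;
  adj : rel vertex;
  adj_sym : symmetric adj;
  adj_irrefl : irreflexive adj
}.

Definition edges (G : sgraph) : {set {set G}} :=
  [set [set x; y] | x in G, y in adj x].

Lemma null_adj_sym (m : nat) : symmetric (fun _ _ : 'I_m => false).
Proof. by []. Qed.

Lemma null_adj_irrefl (m : nat) : irreflexive (fun _ _ : 'I_m => false).
Proof. by []. Qed.

Definition null_graph (m : nat) : sgraph :=
  SGraph (@null_adj_sym m) (@null_adj_irrefl m).

Definition join_adj (G H : sgraph) (x y : G + H) : bool :=
  match x, y with
  | inl u, inl v => adj u v
  | inr u, inr v => adj u v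
  | _, _ => true
  end.

Lemma join_adj_sym (G H : sgraph) : symmetric (@join_adj G H).
Proof. by move=> [x|x] [y|y] //=; apply: adj_sym. Qed.

Lemma join_adj_irrefl (G H : sgraph) : irreflexive (@join_adj G H).
Proof. by move=> [x|x] /=; apply: adj_irrefl. Qed.

Definition graph_join (G H : sgraph) : sgraph :=
  SGraph (@join_adj_sym G H) (@join_adj_irrefl G H).

Definition colorable (G : sgraph) (k : nat) : bool :=
  [exists c : {ffun G -> 'I_k}, [forall x, forall y, adj x y ==> (c x != c y)]].

Lemma colorable_ex (G : sgraph) : exists k, colorable G k.
Proof.
exists #|G|; apply/existsP; exists [ffun x => enum_rank x].
apply/forallP=> x; apply/forallP=> y; apply/implyP=> xy; rewrite !ffunE.
by apply/eqP=> /enum_rank_inj exy; rewrite exy adj_irrefl in xy.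
Qed.

Definition chromatic_number (G : sgraph) : nat := ex_minn (colorable_ex G).

Definition partition_family (T : finType) (t : nat) (B : 'I_t -> {set T}) :=
  forall x, exists! l, x \in B l.

(* The blocks are possibly empty; nonemptiness is a separate requirement. *)
Definition partite_sets (G : sgraph) (t : nat) (V : 'I_t -> {set G}) :=
  partition_family V /\
  forall l x y, x \in V l -> y \in V l -> ~~ adj x y.

(* The disjoint union of V(G) and E(G). A labeling is a function on
   G + {set G}; its values on sets that are not edges are irrelevant. *)
Definition elements (G : sgraph) : {set G + {set G}} :=
  [set z | match z with inl _ => true | inr e => e \in edges G end].

Definition bijective_total_labeling (G : sgraph) (f : G + {set G} -> nat) :=
  {in elements G &, injective f} /\
  forall k, (exists2 z, z \in elements G & f z = k)
            <-> 1 <= k <= #|G| + #|edges G|.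

Definition tn_color (G : sgraph) (f : G + {set G} -> nat) (u : G) : nat :=
  \sum_(x | adj u x) (f (inr [set u; x]) + f (inl x)).

Definition c_tn (G : sgraph) (f : G + {set G} -> nat) : nat :=
  size (undup [seq tn_color f u | u : G]).

Definition ltna_labeling (G : sgraph) (f : G + {set G} -> nat) :=
  bijective_total_labeling f /\
  forall u v, adj u v -> tn_color f u != tn_color f v.

(* The number chi_ltna is defined only for some graphs, hence a relation. *)
Definition is_chi_ltna (G : sgraph) (k : nat) :=
  [/\ 1 < #|G|,
      forall u : G, exists v, adj u v,
      exists2 f : G + {set G} -> nat, ltna_labeling f & c_tn f = k
    & forall f : G + {set G} -> nat, ltna_labeling f -> k <= c_tn f].

(* The values of F on B, with multiplicity, are in some order
   a, a + d, ..., a + (#|B| - 1) d. If #|B| = 1, the only value is a and d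
   plays no role. The difference d can have any sign. *)
Definition arithmetic_on (T : finType) (B : {set T}) (F : T -> nat)
    (a : nat) (d : int) : bool :=
  perm_eq [seq (F x)%:Z%R | x in B]
          (mkseq (fun k => a%:Z + d *+ k)%R #|B|).

(* Main.v *)
(** Keep the labels of [g] on [G], label the edge joining [u] to the [j]-th
    vertex of the null graph by [p + q + A (r u) j], and that vertex by
    [p + q + p m + j + 1] (counting [j] from 0). The bijection [r] from vertices
    to rows pairs the [k]-th term of the progression of colors of [V l], with
    difference [d l], with the [k]-th row sum of [R l], with difference [- d l],
    so the increments cancel and [V l] receives a single color; the vertices of
    the null graph share one further color. Conversely, in any local labeling
    the color of a vertex of the null graph is not used on [G], so that [G] is
    colored with one color less. *)

Require Import Defs.
From mathcomp Require Import all_boot all_order all_algebra.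
From Stdlib Require Import Classical.
From mathcomp Require Import zify.

Set Implicit Arguments.
Unset Strict Implicit.
Unset Printing Implicit Defensive.

(** * Counting and matching of values on finite types *)

(** Pigeonhole: the list of values on [E] has the members and the length of [iota 1 #|E|], hence no
    repetition. *)
Lemma onto_interval_inj (T : finType) (E : {set T}) (f : T -> nat) :
  (forall k, (exists2 z, z \in E & f z = k) <-> 1 <= k <= #|E|) ->
  {in E &, injective f}.
Proof.
move=> fE; apply/dinjectiveP; rewrite /dinjectiveb.
rewrite (@eq_uniq _ _ (iota 1 #|E|)) ?iota_uniq //.
  by rewrite size_map size_iota -cardE.
move=> k; rewrite mem_iota add1n ltnS; apply/mapP/idP.
  by case=> z; rewrite mem_enum => zE ->; apply/fE; exists z.
by case/fE=> z zE <-; exists z; rewrite ?mem_enum.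
Qed.

(** The permutation of positions behind [perm_eq], read through the enumerations of [T] and [T'], is
    the map [r]. *)
Lemma perm_eq_reindex (T T' : finType) (S : eqType) (F : T -> S) (H : T' -> S) :
  perm_eq [seq F x | x : T] [seq H x | x : T'] ->
  exists2 r : T -> T', bijective r & forall x, F x = H (r x).
Proof.
move=> FH; have cTT' : #|T'| = #|T|.
  by move/perm_size: FH; rewrite !size_image.
suff [r rinj rE] : exists2 r : T -> T', injective r & forall x, F x = H (r x).
  by exists r => //; apply: inj_card_bij; rewrite ?cTT'.
(* [nth] needs a default element of [T']; if there is none, [T] is empty as well. *)
case: (pickP T') => [y0 _|T'0]; last first.
  have T0 (x : T) : False.
    by have := max_card (pred1 x); rewrite -cTT' (eq_card0 T'0) card1.
  by exists (fun x => False_rect _ (T0 x)) => x; case: (T0 x).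
have /(perm_iotaP (H y0))[Is permI eqF] := FH.
have sI : size Is = #|T| by rewrite (perm_size permI) size_iota size_image.
have uI : uniq Is by rewrite (perm_uniq permI) iota_uniq.
have inI (x : T) : nth 0 Is (enum_rank x) < size (enum T').
  have : nth 0 Is (enum_rank x) \in Is by rewrite mem_nth // sI.
  by rewrite (perm_mem permI) mem_iota size_map.
pose r (x : T) := nth y0 (enum T') (nth 0 Is (enum_rank x)).
exists r => [|x].
  move=> x y /eqP; rewrite /r nth_uniq ?enum_uniq // nth_uniq ?sI //.
  by move/eqP/val_inj/enum_rank_inj.
have <- : nth (H y0) [seq F x | x : T] (enum_rank x) = F x.
  by rewrite (nth_map x) ?nth_enum_rank -?cardE.
by rewrite eqF (nth_map 0) ?sI // (nth_map y0).
Qed.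

Lemma partition_family_index (T : finType) (t : nat) (B : 'I_t -> {set T}) :
  partition_family B -> exists h : T -> 'I_t, forall x l, (x \in B l) = (h x == l).
Proof.
move=> Bpart; have /fin_all_exists[h hB] :
    forall x, exists l0, forall l, (x \in B l) = (l0 == l).
  move=> x; have [l0 [xl0 ul0]] := Bpart x; exists l0 => l.
  by apply/idP/eqP => [/ul0|<-].
by exists h.
Qed.

(** On block [l], replacing [H y] by [a l + b l - H y] turns the progression from [b l] with
    difference [- d l] into the one from [a l] with difference [d l]. So [F] and [H'] have the same
    multiset of values on [V l] and [W l]. The values are integers because [d l] may be negative. *)
Lemma arithmetic_matching (T T' : finType) (t : nat)
    (V : 'I_t -> {set T}) (W : 'I_t -> {set T'}) (F : T -> nat) (H : T' -> nat)
    (a b : 'I_t -> nat) (d : 'I_t -> int) :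
  partition_family V -> partition_family W -> (forall l, #|W l| = #|V l|) ->
  (forall l, arithmetic_on (V l) F (a l) (d l)) ->
  (forall l, arithmetic_on (W l) H (b l) (- d l)%R) ->
  exists2 r : T -> T', bijective r &
    forall l x, x \in V l -> F x + H (r x) = a l + b l.
Proof.
move=> Vpart Wpart cVW arV arW.
have [h hV] := partition_family_index Vpart.
have [k kW] := partition_family_index Wpart.
pose H' y : int := ((a (k y) + b (k y))%:Z - (H y)%:Z)%R.
have permVW l : perm_eq [seq (F x)%:Z%R | x in V l] [seq H' x | x in W l].
  rewrite (perm_trans (arV l)) // perm_sym.
  have -> : [seq H' x | x in W l] =
            [seq ((a l + b l)%:Z - z)%R | z <- [seq (H x)%:Z%R | x in W l]].
    rewrite -map_comp; apply/eq_in_map => x; rewrite mem_enum kW => /eqP kx.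
    by rewrite /H' kx.
  rewrite (perm_trans (perm_map _ (arW l))) // cVW /mkseq -map_comp.
  apply/permP => P; congr count; apply/eq_map => i /=.
  by rewrite GRing.mulNrn; lia.
(* Tagging each value with its block glues the blockwise permutations into a single one, so that [r]
   is one global bijection that respects blocks. *)
have /perm_eq_reindex[r rbij rE] :
    perm_eq [seq (h x, (F x)%:Z%R) | x : T] [seq (k y, H' y) | y : T'].
  apply/allP => -[l v] _ /=; apply/eqP; rewrite !count_map.
  have /permP/(_ (pred1 v)) := permVW l.
  rewrite !count_map !count_filter => E.
  transitivity (count (predI (preim (fun x => (F x)%:Z%R) (pred1 v)) (mem (V l)))
                      (Finite.enum T)).
    by apply: eq_count => x /=; rewrite hV xpair_eqE andbC ?andbT.
  by rewrite E; apply: eq_count => y /=; rewrite kW xpair_eqE andbC ?andbT.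
exists r => // l x; rewrite hV => /eqP hx; case: (rE x); rewrite /H' => <-.
rewrite hx; lia.
Qed.

(** * Edges of the join with a null graph *)

Lemma set2_eqP (T : finType) (x y u v : T) :
  [set x; y] = [set u; v] -> (x = u /\ y = v) \/ (x = v /\ y = u).
Proof.
move=> E; have [xI yI] : x \in [set u; v] /\ y \in [set u; v].
  by rewrite -E set21 set22.
have [uI vI] : u \in [set x; y] /\ v \in [set x; y] by rewrite E set21 set22.
case/set2P: xI => ?; case/set2P: yI => ?; case/set2P: uI => ?; case/set2P: vI => ?.
all: by subst; auto.
Qed.

Lemma mem_edges (G : sgraph) (x y : G) : ([set x; y] \in edges G) = adj x y.
Proof.
apply/idP/idP => [|xy]; last by apply/imset2P; exists x y.
by case/imset2P => u v _ uv /set2_eqP[][-> ->] //; rewrite adj_sym.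
Qed.

Lemma edgesP (G : sgraph) (e : {set G}) :
  reflect (exists x y, adj x y /\ e = [set x; y]) (e \in edges G).
Proof.
apply: (iffP imset2P) => [[x y _ xy ->]|[x [y [xy ->]]]]; first by exists x, y.
by exists x y.
Qed.

Section JoinNullGraph.

Variables (G : sgraph) (m : nat).

Local Notation J := (graph_join G (null_graph m)).

Definition cross_edge (w : G * 'I_m) : {set J} := [set (inl w.1 : J); (inr w.2 : J)].

Definition left_edge (e : {set G}) : {set J} := [set (inl x : J) | x in e].

Lemma cross_edge_inj : injective cross_edge.
Proof. by move=> [u i] [v j] /set2_eqP[][] //= [->] [->]. Qed.

Lemma left_edge_inj : injective left_edge.
Proof. by apply: imset_inj => x y []. Qed.

Lemma left_edge_set2 (x y : G) : left_edge [set x; y] = [set (inl x : J); (inl y : J)].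
Proof. by rewrite /left_edge imsetU1 imset_set1. Qed.

Lemma cross_edge_neq_left (w : G * 'I_m) (e : {set G}) : cross_edge w != left_edge e.
Proof.
apply/eqP => E; have : (inr w.2 : J) \in cross_edge w by rewrite set22.
by rewrite E => /imsetP[].
Qed.

Lemma edges_join_null :
  edges J = [set left_edge e | e in edges G] :|: [set cross_edge w | w : G * 'I_m].
Proof.
apply/setP => e; rewrite inE; apply/edgesP/orP.
  case=> -[x|i] [[y|j] [xy ->]] //.
  - by left; apply/imsetP; exists [set x; y]; rewrite ?mem_edges ?left_edge_set2.
  - by right; apply/imsetP; exists (x, j).
  - by right; apply/imsetP; exists (y, i); rewrite // setUC.
case=> /imsetP[].
  move=> _ /edgesP[x [y [xy ->]]] ->; exists (inl x), (inl y).
  by rewrite left_edge_set2.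
by move=> [x j] _ ->; exists (inl x), (inr j).
Qed.

Lemma card_edges_join_null : #|edges J| = #|edges G| + #|G| * m.
Proof.
rewrite edges_join_null cardsU card_imset ?(card_imset _ cross_edge_inj); last first.
  exact: left_edge_inj.
rewrite card_prod card_ord (_ : _ :&: _ = set0) ?cards0 ?subn0 //.
apply/setP => e; rewrite !inE; apply/andP => -[/imsetP[e' _ ->] /imsetP[w _]].
by move/eqP; rewrite eq_sym (negPf (cross_edge_neq_left _ _)).
Qed.

Lemma card_elements (H : sgraph) : #|elements H| = #|H| + #|edges H|.
Proof.
rewrite -sum1_card big_sumType /= -!sum1_card; congr (_ + _); apply: eq_bigl => z.
all: by rewrite inE.
Qed.

(** Injectivity comes from counting, so for the labeling of the join only its set of values has to
    be determined. *)
Lemma onto_bijective_total_labeling (H : sgraph) (f : H + {set H} -> nat) :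
  (forall k, (exists2 z, z \in elements H & f z = k)
             <-> 1 <= k <= #|H| + #|edges H|) ->
  bijective_total_labeling f.
Proof. by move=> fE; split=> //; apply: onto_interval_inj; rewrite card_elements. Qed.

(** * The labeling of the join and its induced colors *)

Variables (g : G + {set G} -> nat) (B : G -> 'I_m -> nat).

Let n := #|G| + #|edges G|.

(** [B] stands for the matrix with its rows indexed by vertices. Edges are bare sets: a cross edge
    is recognized by searching for its endpoints, and any other set is pulled back to [G] along
    [inl]. *)
Definition join_labeling (z : J + {set J}) : nat :=
  match z with
  | inl (inl u) => g (inl u)
  | inl (inr j) => n + #|G| * m + j.+1
  | inr e => if [pick w | e == cross_edge w] is Some w then n + B w.1 w.2
             else g (inr [set x | (inl x : J) \in e])
  end.

Lemma join_labeling_cross (u : G) (j : 'I_m) :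
  join_labeling (inr [set (inl u : J); (inr j : J)]) = n + B u j.
Proof.
rewrite /=; case: pickP => [w /eqP E|/(_ (u, j))/eqP//].
by rewrite -(cross_edge_inj (E : cross_edge (u, j) = _)).
Qed.

Lemma join_labeling_left (e : {set G}) : join_labeling (inr (left_edge e)) = g (inr e).
Proof.
rewrite /=; case: pickP => [w|_].
  by rewrite eq_sym (negPf (cross_edge_neq_left _ _)).
congr (g (inr _)); apply/setP => x; rewrite inE mem_imset //.
by move=> ? ? [].
Qed.

Hypothesis g_label : bijective_total_labeling g.
Hypothesis B_onto : forall k, (exists u j, B u j = k) <-> 1 <= k <= #|G| * m.

Lemma join_labeling_bijective : bijective_total_labeling join_labeling.
Proof.
have [_ g_onto] := g_label.
apply: onto_bijective_total_labeling => k.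
have -> : #|J| + #|edges J| = n + #|G| * m + m.
  rewrite card_edges_join_null (_ : #|J| = #|G| + m); last by rewrite card_sum card_ord.
  by rewrite addnACA [m + _]addnC addnA.
split.
  case=> -[[u|j]|e] + <-; rewrite inE /=.
  - move=> _; have : 1 <= g (inl u) <= n by apply/g_onto; exists (inl u); rewrite ?inE.
    by lia.
  - by have := ltn_ord j; lia.
  - rewrite edges_join_null !inE => /orP[]/imsetP[x xG ->].
      rewrite -/(join_labeling (inr _)) join_labeling_left.
      have /andP[g1 gn] : 1 <= g (inr x) <= n by apply/g_onto; exists (inr x); rewrite ?inE.
      by rewrite g1 (leq_trans gn) // -addnA leq_addr.
    rewrite -/(join_labeling (inr _)) join_labeling_cross.
    have /andP[B1 Bm] : 1 <= B x.1 x.2 <= #|G| * m by apply/B_onto; exists x.1, x.2.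
    by rewrite addn_gt0 B1 orbT -addnA leq_add2l (leq_trans Bm) ?leq_addr.
(* The range splits into three consecutive intervals: labels of [g], cross edges, null vertices. *)
move=> k_range; have [kn|nk] := leqP k n.
  have /g_onto[[u|e]] : 1 <= k <= n by lia.
    by move=> _ <-; exists (inl (inl u)); rewrite ?inE.
  rewrite inE => eG <-; exists (inr (left_edge e)); last exact: join_labeling_left.
  by rewrite inE edges_join_null inE imset_f.
have [knm|nmk] := leqP k (n + #|G| * m).
  have /B_onto[u [j Bk]] : 1 <= k - n <= #|G| * m by lia.
  exists (inr (cross_edge (u, j))); last by rewrite join_labeling_cross Bk; lia.
  by rewrite inE edges_join_null inE imset_f ?orbT.
(* The predecessor appears because ordinals start at 0 while the label adds [j.+1]. *)
have jm : (k - (n + #|G| * m)).-1 < m by lia.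
exists (inl (inr (Ordinal jm))); first by rewrite inE.
rewrite [LHS]/=.
have -> : (k - (n + #|G| * m)).-1.+1 = k - (n + #|G| * m) by rewrite prednK ?subn_gt0.
by rewrite subnKC // ltnW.
Qed.

(** The [j]-th null vertex adds [n + B u j] for the edge and [n + #|G| * m + j.+1] for itself;
    summing over [j] gives the row sum and a shift independent of [u]. *)
Lemma tn_color_join_left (u : G) :
  tn_color join_labeling (inl u : J) =
  tn_color g u + \sum_j B u j + m * (2 * #|G| + 2 * #|edges G| + #|G| * m)
  + (m * (m + 1)) %/ 2.
Proof.
rewrite /tn_color big_sumType /=.
under eq_bigr => x _ do rewrite -/(join_labeling (inr _)) -left_edge_set2 join_labeling_left.
rewrite -!addnA; congr (_ + _).
under eq_bigr => j _ do rewrite -/(join_labeling (inr _)) join_labeling_cross.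
have -> : (m * (m + 1)) %/ 2 = \sum_(j < m) j.+1.
  by elim: (m) => [|k IH]; rewrite ?big_ord0 // big_ord_recr /= -IH; lia.
rewrite !big_split /= !sum_nat_const card_ord; rewrite /n; lia.
Qed.

(** The label of [j] itself does not enter its color, which thus depends on [j] only through a
    column sum. *)
Lemma tn_color_join_right (j : 'I_m) :
  tn_color join_labeling (inr j : J) =
  \sum_u g (inl u) + \sum_u B u j + #|G| * (#|G| + #|edges G|).
Proof.
rewrite /tn_color big_sumType /= [X in _ + X]big_pred0 // addn0.
under eq_bigr => u _ do rewrite setUC -/(join_labeling (inr _)) join_labeling_cross.
by rewrite !big_split /= !sum_nat_const -mulnDr addnC [X in _ + X]addnC addnA.
Qed.

End JoinNullGraph.

(** * The lower bound and the minimum *)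

Lemma chromatic_number_min (G : sgraph) (k : nat) :
  colorable G k -> chromatic_number G <= k.
Proof. by rewrite /chromatic_number; case: ex_minnP => c _; apply. Qed.

Lemma chromatic_number_lt_c_tn (G : sgraph) (m : nat)
    (f : graph_join G (null_graph m) + {set graph_join G (null_graph m)} -> nat) :
  0 < m -> ltna_labeling f -> chromatic_number G < c_tn f.
Proof.
move=> m_gt0 [_ f_proper]; pose j : 'I_m := Ordinal m_gt0.
pose J := graph_join G (null_graph m).
pose c (x : J) := tn_color f x.
pose s := undup [seq c x | x : J].
have cs x : c x \in s by rewrite mem_undup map_f // mem_enum.
(* The vertex [j] is adjacent to all of [G], so every color used on [G] survives in [s']; its index
   there is a proper coloring with one color less. *)
pose s' := rem (c (inr j)) s.
have cs' (u : G) : index (c (inl u)) s' < size s'.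
  by rewrite index_mem mem_rem_uniq ?undup_uniq // inE cs andbT f_proper.
have <- : (size s').+1 = c_tn f.
  by rewrite size_rem ?cs // prednK // -has_predT; apply/hasP; exists (c (inr j)).
apply: chromatic_number_min; apply/existsP; exists [ffun u => Ordinal (cs' u)].
apply/forallP => u; apply/forallP => v; apply/implyP => uv; rewrite !ffunE.
apply/eqP => -[] /(congr1 (nth 0 s')); rewrite !nth_index -?index_mem ?cs' //.
by apply/eqP/f_proper.
Qed.

(** To be applied to the color counts of all labelings, a predicate that is not boolean; excluded
    middle decides whether a smaller witness exists. *)
Lemma ex_minimal_nat (P : nat -> Prop) :
  (exists n, P n) -> exists2 k, P k & forall n, P n -> k <= n.
Proof.
case=> n; elim/ltn_ind: n => n IH Pn.
case: (classic (exists2 k, P k & k < n)) => [[k Pk /IH]|no_smaller]; first exact.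
by exists n => // k Pk; rewrite leqNgt; apply/negP => kn; apply: no_smaller; exists k.
Qed.

Theorem theorem2p1 (p q m t : nat) (G : sgraph)
    (V : 'I_t -> {set G}) (g : G + {set G} -> nat)
    (A : 'M[nat]_(p, m)) (R : 'I_t -> {set 'I_p})
    (alpha beta : 'I_t -> nat) (d : 'I_t -> int)
    (p_ge2 : 2 <= p) (p_even : ~~ odd p) (m_ge3 : 3 <= m) (m_odd : odd m)
    (G_order : #|G| = p) (G_size : #|edges G| = q)
    (* (a) *)
    (t_ge2 : 2 <= t)
    (V_partite : partite_sets V)
    (V_nonempty : forall l, 1 <= #|V l|)
    (V_mono : forall l l' : 'I_t, l' = l.+1 :> nat -> #|V l| <= #|V l'|)
    (* (b) *)
    (g_label : bijective_total_labeling g)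
    (g_arith : forall l, arithmetic_on (V l) (tn_color g) (alpha l) (d l))
    (* (A) *)
    (A_entries : forall k, (exists i j, A i j = k) <-> 1 <= k <= p * m)
    (A_cols : forall j, \sum_i A i j = (p * (p * m + 1)) %/ 2)
    (R_partition : partition_family R)
    (R_card : forall l, #|R l| = #|V l|)
    (R_arith : forall l,
       arithmetic_on (R l) (fun i => \sum_j A i j) (beta l) (- d l)%R)
    (* (i) *)
    (colors_distinct : forall l l' : 'I_t, l < l' ->
       alpha l + beta l != alpha l' + beta l')
    (* (ii) *)
    (colors_neq_null : forall l,
       alpha l + beta l + m * (2 * p + 2 * q + p * m) + (m * (m + 1)) %/ 2
       != \sum_(u : G) g (inl u) + (p * (p * m + 1)) %/ 2 + p * (p + q)) :
  exists k, [/\ is_chi_ltna (graph_join G (null_graph m)) k,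
                k <= t + 1
              & chromatic_number G = t -> k = t + 1].

Proof.
have m_gt0 : 0 < m by apply: leq_trans m_ge3.
have p_gt0 : 0 < #|G| by rewrite G_order; apply: leq_trans p_ge2.
pose J := graph_join G (null_graph m).
have [r rbij rE] := arithmetic_matching (proj1 V_partite) R_partition R_card g_arith R_arith.
pose B (u : G) j := A (r u) j.
have B_onto k : (exists u j, B u j = k) <-> 1 <= k <= #|G| * m.
  rewrite G_order -A_entries; split=> [[u [j <-]]|[i [j <-]]]; first by exists (r u), j.
  by have [r' _ r'K] := rbij; exists (r' i), j; rewrite /B r'K.
pose f := join_labeling g B.
have [h hV] := partition_family_index (proj1 V_partite).
(* [K] is the common shift of the colors on [G], and [C0] the single color of the null vertices. *)
pose K := m * (2 * p + 2 * q + p * m) + (m * (m + 1)) %/ 2.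
pose C0 := \sum_(u : G) g (inl u) + (p * (p * m + 1)) %/ 2 + p * (p + q).
have fl (u : G) : tn_color f (inl u : J) = alpha (h u) + beta (h u) + K.
  rewrite tn_color_join_left (rE (h u)) ?hV //.
  by rewrite G_order G_size -addnA.
have fr (j : 'I_m) : tn_color f (inr j : J) = C0.
  rewrite tn_color_join_right G_order G_size; congr (_ + _ + _).
  by rewrite -(A_cols j) (reindex r) //; apply: onW_bij.
have lr u j : tn_color f (inl u : J) != tn_color f (inr j : J).
  by rewrite fl fr addnA colors_neq_null.
have f_ltna : ltna_labeling f.
  split; first exact: join_labeling_bijective.
  move=> [u|i] [v|j] //= uv; rewrite ?lr // 1?eq_sym ?lr // !fl eqn_add2r.
  (* Adjacent vertices lie in different blocks, whose colors differ by (i). *)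
  have huv : h u != h v.
    by apply: contraTneq uv => E; apply: (proj2 V_partite (h u)); rewrite hV ?E.
  case: (ltngtP (h u) (h v)) => [/colors_distinct|/colors_distinct//|E].
    by rewrite eq_sym.
  by case/eqP: huv; apply: val_inj.
have c_f : c_tn f <= t + 1.
  have -> : t + 1 = size (C0 :: [seq alpha l + beta l + K | l : 'I_t]).
    by rewrite /= size_image card_ord addn1.
  apply: uniq_leq_size; first exact: undup_uniq.
  move=> c; rewrite mem_undup => /mapP[[u|j] _ ->]; last by rewrite fr mem_head.
  by rewrite in_cons fl; apply/orP; right; apply/mapP; exists (h u); rewrite ?mem_enum.
have [|k [f' f'_ltna c_f'] k_min] :=
    @ex_minimal_nat (fun k => exists2 f : J + {set J} -> nat, ltna_labeling f & c_tn f = k).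
  by exists (c_tn f), f.
have k_le : k <= t + 1 by apply: leq_trans c_f; apply: k_min; exists f.
exists k; split=> //; last first.
  (* The minimum is attained by [f'], whose color count exceeds the chromatic number [t]. *)
  move=> chi; apply/eqP; rewrite eqn_leq k_le addn1 -c_f' -chi.
  exact: chromatic_number_lt_c_tn.
split.
- by rewrite card_sum G_order; apply: leq_trans (leq_addr _ _).
- case=> [u|j]; first by exists (inr (Ordinal m_gt0)).
  by have /card_gt0P[u _] := p_gt0; exists (inl u).
- by exists f'.
- by move=> f'' f''_ltna; apply: k_min; exists f''.
Qed.
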